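(* Let $N$ be any odd positive integer. For every $k\in\mathbb{N}$ and every $x\in\mathbb{C}$ with $|x|\leq 1$, $$ \begin{aligned} & \sum_{\nu=1}^{k} \bigg\{ \sum_{\substack{m,n\geq 1 \\ m \equiv n\ (\mathrm{mod}\ N)}}\frac{x^n}{n^\nu(m+n)^{k+2-\nu}}\bigg\}+\sum_{\substack{m,n\geq 1 \\ m \equiv n\ (\mathrm{mod}\ N)}}\frac{x^n}{m(m+n)^{k+1}} \\ & \quad +\sum_{\nu=1}^{k} \bigg\{ \sum_{\substack{m,n\geq 1 \\ m \equiv -2n\ (\mathrm{mod}\ N)}} \frac{x^n}{n^\nu(m+n)^{k+2-\nu}}\bigg\}+ \sum_{\substack{m,n\geq 1 \\ m \equiv -2n\ (\mathrm{mod}\ N)}} \frac{x^n}{m(m+n)^{k+1}}\\ & \quad - \sum_{\substack{m,n\geq 1 \\ m \equiv -2n\ (\mathrm{mod}\ N)}} \frac{x^{m+n}}{m(m+n)^{k+1}}- \sum_{\substack{m,n\geq 1 \\ m \equiv -2n\ (\mathrm{mod}\ N)}} \frac{x^{m+n}}{n(m+n)^{k+1}}\\ & =\frac{2}{N^{k+2}}\mathrm{Li}(k+2;x^N)+\frac{\pi}{N}\sum_{\substack{m\geq 1\\ N\nmid m}} \frac{x^m}{\sin(2m\pi/N)\,m^{k+1}}. \end{aligned} $$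
   Context: $\mathbb{N}$ is the set of positive integers; the summation variables $m,n$ are integers. $\mathrm{Li}(s;x)=\sum_{n\geq 1} x^n n^{-s}$. Empty sums are $0$ (so the last sum on the right is $0$ when $N=1$). *)

(* Defs.v *)
From mathcomp Require Import all_boot all_order all_algebra.
From mathcomp Require Import finmap complex.
From mathcomp Require Import all_classical all_reals all_analysis.
From mathcomp Require summability.

Set Implicit Arguments.
Unset Strict Implicit.
Unset Printing Implicit Defensive.

Import Order.TTheory GRing.Theory Num.Theory numFieldNormedType.Exports.

Local Open Scope classical_set_scope.
Local Open Scope ring_scope.

(* The topology on the complex numbers is that of the normed module R[i]^o
   over itself. *)

(* Double series over the pairs of integers m, n >= 1 with D m n, read as
   unordered sums: limits of the finite partial sums along the directed set of
   finite sets of pairs (for complex terms, this is absolute convergence). *)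
Definition dterm (R : realType) (D : rel nat) (a : nat -> nat -> R[i])
    (p : nat * nat) : R[i]^o :=
  if [&& (0 < p.1)%N, (0 < p.2)%N & D p.1 p.2] then a p.1 p.2 else 0.

Definition dsummable (R : realType) (D : rel nat) (a : nat -> nat -> R[i]) :
    Prop :=
  cvg (summability.partial_sum (dterm D a) @ summability.totally).

Definition dsum (R : realType) (D : rel nat) (a : nat -> nat -> R[i]) : R[i] :=
  summability.sum (dterm D a).

(* Simple series over the integers n >= 1 with P n. *)
Definition psums (R : realType) (P : pred nat) (a : nat -> R[i]) (n : nat) :
    R[i]^o :=
  \sum_(1 <= i < n | P i) a i.

Definition csummable (R : realType) (P : pred nat) (a : nat -> R[i]) : Prop :=
  cvgn (psums P a).

Definition csum (R : realType) (P : pred nat) (a : nat -> R[i]) : R[i] :=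
  limn (psums P a).

Definition Li_term (R : realType) (s : nat) (x : R[i]) (n : nat) : R[i] :=
  x ^+ n / n%:R ^+ s.

Definition Li (R : realType) (s : nat) (x : R[i]) : R[i] :=
  csum xpredT (Li_term s x).

(* Main.v *)
Require Import Defs.
From mathcomp Require Import all_boot all_order all_algebra.
From mathcomp Require Import finmap complex.
From mathcomp Require Import all_classical all_reals all_analysis.
From mathcomp Require summability.
From mathcomp Require Import ring lra zify.

(* By partial fractions in [n], [m + n], the first four families of sums
   collapse to [x^n / (m n^k (m + n))] over the two residue classes, and the
   last two to [x^l / l^k] times [1 / (n (l - n))] on the diagonals [l = m +
   n]. The coefficient of [x^l / l^k] in the whole expression is the sum of
   [1 / (m (m + l))] over all integers [m = l (mod N)] other than [0] and
   [-l]: the class of [l] gives [m > 0], the diagonal gives [-l < m < 0],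
   and the class of [-2 l] gives [m < -l]. Telescoping [1/m - 1/(m + l)]
   leaves [2 / l^2] if [N] divides [l]; otherwise the cotangent series gives
   [pi / (N l) (cot a - cot (2 a))] with [a = pi l / N], and [cot a - cot (2
   a) = 1 / sin (2 a)].

   The cotangent series: let [h M] be [pi cot (pi t)] minus its [M]-th
   symmetric partial sum. Then [h (2 M) t = (h M (t/2) + h M ((t+1)/2)) /
   2], which halves the Lipschitz constant on ]0, 1[; as [h 1] is Lipschitz
   and [h M (1/2) = 0], the error [h (2^n)] tends to [0]. *)

Set Implicit Arguments.
Unset Strict Implicit.
Unset Printing Implicit Defensive.

Import Order.TTheory GRing.Theory Num.Theory numFieldNormedType.Exports.
Import summability.

Local Open Scope ring_scope.

(* Declared inside a section of [summability], hence not exported by it. *)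
#[local] Existing Instance totally_filter.

(** * The cotangent series *)

Lemma derive_bound_lipschitz (R : realType) (f df : R -> R) (a b C : R) :
  {in `]a, b[, forall y : R, is_derive y 1 f (df y) /\ `|df y| <= C} ->
  {in `]a, b[ &, forall y z : R, `|f y - f z| <= C * `|y - z|}.
Proof.
move=> fd y z yI zI; wlog : y z yI zI / z <= y => [H|zy].
  have [/H|/ltW /H] := leP z y; first exact.
  by rewrite distrC (distrC z); exact.
have inab w : w \in `[z, y] -> w \in `]a, b[.
  move: yI zI; rewrite !in_itv /= => /andP[_ yb] /andP[az _] /andP[zw wy].
  by rewrite (lt_le_trans az zw) (le_lt_trans wy yb).
have [w wzy||c cI ->] := @MVT_segment R f df z y zy.
- by have [] := fd w (inab w (subset_itv_oo_cc wzy)).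
- apply: derivable_within_continuous => w wzy.
  by have [[]] := fd w (inab w wzy).
rewrite normrM ler_wpM2r//.
by have [] := fd c (inab c cI).
Qed.

Definition cot {R : realType} (y : R) : R := cos y / sin y.

(** This bound and the next two form a chain, each following from the previous one by the mean value
    theorem on [0, y]. The constants are cruder than the Taylor ones. *)
Lemma sin_le_id (R : realType) (y : R) : 0 <= y -> sin y <= y.
Proof.
move=> y0.
have [|c _] := @MVT_segment R sin cos 0 y y0.
  by apply: continuous_subspaceT; exact: continuous_sin.
rewrite sin0 !subr0 => ->.
by rewrite ler_piMl// cos_le1.
Qed.

Lemma cos_ge_1_sub_sqr (R : realType) (y : R) : 0 <= y -> 1 - y ^+ 2 <= cos y.
Proof.
move=> y0.
have [|c] := @MVT_segment R cos (fun z => - sin z) 0 y y0.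
  by apply: continuous_subspaceT; exact: continuous_cos.
rewrite cos0 !subr0 in_itv /= => /andP[c0 cy].
have := sin_le_id c0.
nra.
Qed.

Lemma id_sub_sin_le_cube (R : realType) (y : R) : 0 <= y -> y - sin y <= y ^+ 3.
Proof.
move=> y0.
have [|c] := @MVT_segment R sin cos 0 y y0.
  by apply: continuous_subspaceT; exact: continuous_sin.
rewrite sin0 !subr0 in_itv /= => /andP[c0 cy] ->.
have := cos_ge_1_sub_sqr c0.
have : c ^+ 2 <= y ^+ 2 by rewrite ler_pXn2r// nnegrE.
nra.
Qed.

(** For some 0 <= c <= y/2, sin y = 2 sin (y/2) cos (y/2) = y cos c cos (y/2). Both cosines are at
    least cos (y/2), whose square (1 + cos y)/2 exceeds 1/2. *)
Lemma sin_ge_half (R : realType) (y : R) : 0 < y < pi / 2 -> y / 2 <= sin y.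
Proof.
move=> /andP[y0 ypi].
have y20 : 0 <= y / 2 by lra.
have [|c] := @MVT_segment R sin cos 0 (y / 2) y20.
  by apply: continuous_subspaceT; exact: continuous_sin.
rewrite sin0 !subr0 in_itv /= => /andP[c0 cy] sE.
have cosy : 0 < cos y by apply: cos_gt0_pihalf; lra.
have cos2 : 2^-1 <= cos (y / 2) ^+ 2.
  have := cosD (y / 2) (y / 2); have := sin2cos2 (y / 2); rewrite -splitr; nra.
have cu : 0 < cos (y / 2) by apply: cos_gt0_pihalf; lra.
have cc : cos (y / 2) <= cos c.
  have [->//|ne] := eqVneq c (y / 2).
  have lt_c : c < y / 2 by rewrite lt_neqAle ne.
  by apply: ltW; rewrite ltr_cos ?in_itv//=; apply/andP; split; lra.
have h : 2^-1 <= cos c * cos (y / 2).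
  by apply: (le_trans cos2); rewrite expr2 ler_pM2r.
rewrite [in X in _ <= X](splitr y) sinD sE.
nra.
Qed.

Lemma is_derive_cot (R : realType) (y : R) :
  sin y != 0 -> is_derive y 1 cot (- (sin y ^+ 2)^-1).
Proof.
move=> sy; rewrite /cot.
apply: (@is_derive_eq _ _ _ _ _ _ _ _
  (is_deriveM (is_derive_cos _) (is_deriveV sy (is_derive_sin _)))).
rewrite /GRing.scale /=.
have cs : cos y ^+ 2 = 1 - sin y ^+ 2 by rewrite cos2sin2.
have -> : cos y * (- sin y ^- 2 * cos y) + (sin y)^-1 * - sin y =
    - (sin y ^- 2) * cos y ^+ 2 - 1 by field.
by rewrite cs; field.
Qed.

Lemma cot_sub_inv_lipschitz (R : realType) :
  {in `]0, (pi / 2)[ &, forall y z : R,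
    `|(cot y - y^-1) - (cot z - z^-1)| <= 8 * `|y - z|}.
Proof.
apply: (@derive_bound_lipschitz _ _
  (fun y => - (sin y ^+ 2)^-1 - (- y ^- 2))) => y.
rewrite in_itv /= => yI; have /andP[y0 _] := yI.
have s_ge := sin_ge_half yI; have s_le := sin_le_id (ltW y0).
have s_cub := id_sub_sin_le_cube (ltW y0).
have s0 : 0 < sin y by lra.
split.
  apply: is_deriveB; first by apply: is_derive_cot; rewrite gt_eqF.
  have yn0 : y != 0 by rewrite gt_eqF.
  have := is_deriveV (f := id) yn0 (is_derive_id y 1).
  by rewrite /GRing.scale /= mulr1.
set s := sin y in s_ge s_le s_cub s0 *.
(* With y - s <= y^3, y + s <= 2 y and s >= y/2, the quotient is at most 2 y^4 / (y^4 / 4) = 8. *)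
have -> : - (s ^+ 2)^-1 - - y ^- 2 = - ((y - s) * (y + s) / (y ^+ 2 * s ^+ 2)).
  by field; rewrite !gt_eqF.
rewrite normrN ger0_norm; last first.
  by rewrite divr_ge0// ?mulr_ge0 ?exprn_ge0//; lra.
rewrite ler_pdivrMr ?mulr_gt0 ?exprn_gt0//.
have h1 : (y - s) * (y + s) <= y ^+ 3 * (2 * y).
  by apply: ler_pM; lra.
have h2 : y ^+ 2 * (y / 2) ^+ 2 <= y ^+ 2 * s ^+ 2.
  by rewrite ler_wpM2l ?sqr_ge0// ler_pXn2r// ?nnegrE; lra.
have -> : 8 * (y ^+ 2 * s ^+ 2) = y ^+ 3 * (2 * y) +
    8 * (y ^+ 2 * s ^+ 2 - y ^+ 2 * (y / 2) ^+ 2) by field.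
lra.
Qed.

(** The quotient sin u / cos u is read below as cot (pi/2 - u) and as -cot (u + pi/2). *)
Lemma cot_double (R : realType) (u : R) : sin u != 0 -> cos u != 0 ->
  cot (u + u) = (cot u - sin u / cos u) / 2.
Proof.
move=> su cu; rewrite /cot sinD cosD.
by field; rewrite su cu /= (mulrC (cos u)) -mulr2n mulrn_eq0 /= mulf_neq0.
Qed.

(** The sum of 1 / (t + j) over the integers -M <= j < M, with j and -1 - j paired; this makes it
    odd under t -> 1 - t. *)
Definition cot_psum {R : realType} (M : nat) (t : R) : R :=
  \sum_(j < M) ((t + j%:R)^-1 - (1 - t + j%:R)^-1).

Definition cot_err {R : realType} (M : nat) (t : R) : R :=
  pi * cot (pi * t) - cot_psum M t.

Lemma sin_pi_neq0 (R : realType) (t : R) : 0 < t < 1 -> sin (pi * t) != 0.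
Proof.
move=> /andP[t0 t1]; have p0 := pi_gt0 R.
by rewrite gt_eqF// sin_gt0_pi// mulr_gt0//= gtr_pMr.
Qed.

(** The poles at 0 and 1 are removed separately: doubling at pi t / 2 gives cot (pi t / 2) and cot
    (pi (1 - t) / 2), and each term of [cot_psum 1] compensates one of them. The constant is pi/2 *
    (8 pi/2 + 8 pi/2). *)
Lemma cot_err1_lipschitz (R : realType) :
  {in `]0, 1[ &, forall t s : R,
    `|cot_err 1 t - cot_err 1 s| <= 4 * pi ^+ 2 * `|t - s|}.
Proof.
have p0 := pi_gt0 R.
pose psi (y : R) := cot y - y^-1.
have halfE t : t \in `]0, 1[ -> cot_err 1 t =
    pi / 2 * (psi (pi / 2 * t) - psi (pi / 2 * (1 - t))).
  rewrite in_itv /= => /andP[t0 t1].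
  have sn0 : sin (pi / 2 * t) != 0.
    by rewrite gt_eqF// sin_gt0_pihalf//; apply/andP; split; nra.
  have cn0 : cos (pi / 2 * t) != 0.
    by rewrite gt_eqF// cos_gt0_pihalf//; apply/andP; split; nra.
  rewrite /cot_err /cot_psum big_ord1 /psi.
  have -> : pi * t = pi / 2 * t + pi / 2 * t by field.
  rewrite cot_double//.
  have -> : cot (pi / 2 * (1 - t)) = sin (pi / 2 * t) / cos (pi / 2 * t).
    have -> : pi / 2 * (1 - t) = - (pi / 2 * t - pi / 2) by ring.
    by rewrite /cot cosN sinN cosBpihalf sinBpihalf opprK.
  rewrite /cot /= !addr0.
  move: (pi) p0 sn0 cn0 => p p0 sn0 cn0.
  have p2 : p != 0 by rewrite gt_eqF.
  have t2 : t != 0 by rewrite gt_eqF.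
  have t3 : 1 - t != 0 by rewrite gt_eqF// subr_gt0.
  by field; rewrite sn0 cn0 p2 t2 t3.
move=> t s tI sI; rewrite !halfE//.
have half (y : R) : y \in `]0, 1[ -> (pi / 2 * y) \in `]0, pi / 2[.
  rewrite !in_itv /= => /andP[y0 y1].
  by rewrite mulr_gt0 ?divr_gt0//= gtr_pMr// divr_gt0.
have rev (y : R) : y \in `]0, 1[ -> 1 - y \in `]0, 1[.
  by rewrite !in_itv /= => /andP[y0 y1]; apply/andP; split; lra.
have := cot_sub_inv_lipschitz (half _ tI) (half _ sI).
have := cot_sub_inv_lipschitz (half _ (rev _ tI)) (half _ (rev _ sI)).
rewrite -!mulrBr.
have -> : 1 - t - (1 - s) = - (t - s) by ring.
rewrite mulrN normrN normrM gtr0_norm ?divr_gt0// => h1 h2.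
rewrite normrM gtr0_norm ?divr_gt0//.
have -> : 4 * pi ^+ 2 * `|t - s| =
    pi / 2 * (8 * (pi / 2 * `|t - s|) + 8 * (pi / 2 * `|t - s|)) by field.
apply: ler_wpM2l; first by rewrite divr_ge0// ltW.
apply: le_trans (lerD h2 h1).
apply: le_trans (ler_normB _ _).
by rewrite le_eqVlt; apply/predU1P; left; congr (`| _ |); rewrite /psi; ring.
Qed.

(** The cotangent splits by [cot_double], the partial sum by the parity of the index: t + 2 j = 2
    (t/2 + j) and t + 2 j + 1 = 2 ((t + 1)/2 + j). *)
Lemma cot_err_double (R : realType) (M : nat) (t : R) : 0 < t < 1 ->
  cot_err M.*2 t = (cot_err M (t / 2) + cot_err M ((t + 1) / 2)) / 2.
Proof.
move=> /andP[t0 t1]; have p0 := pi_gt0 R.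
have sn0 : sin (pi / 2 * t) != 0.
  by rewrite gt_eqF// sin_gt0_pihalf//; apply/andP; split; nra.
have cn0 : cos (pi / 2 * t) != 0.
  by rewrite gt_eqF// cos_gt0_pihalf//; apply/andP; split; nra.
have cE : cot (pi * t) = (cot (pi * (t / 2)) + cot (pi * ((t + 1) / 2))) / 2.
  have -> : pi * t = pi / 2 * t + pi / 2 * t by field.
  rewrite cot_double//.
  have -> : pi * ((t + 1) / 2) = pi / 2 * t + pi / 2 by ring.
  have -> : pi * (t / 2) = pi / 2 * t by ring.
  by rewrite {3}/cot cosDpihalf sinDpihalf mulNr.
suff sE : cot_psum M.*2 t =
    (cot_psum M (t / 2) + cot_psum M ((t + 1) / 2)) / 2.
  by rewrite /cot_err cE sE; field.
rewrite /cot_psum -big_split /= mulr_suml.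
elim: M => [|M IH]; first by rewrite !big_ord0.
rewrite doubleS !big_ord_recr /= IH -addrA; congr (_ + _).
have M0 : 0 <= M%:R :> R by [].
rewrite -addn1 natrD -mul2n natrM.
field; rewrite ?gt_eqF//; lra.
Qed.

Lemma cot_err_lipschitz (R : realType) (n : nat) :
  {in `]0, 1[ &, forall t s : R,
    `|cot_err (2 ^ n) t - cot_err (2 ^ n) s| <=
      4 * pi ^+ 2 / 2 ^+ n * `|t - s|}.
Proof.
elim: n => [|n IH] t s tI sI; first by rewrite divr1; exact: cot_err1_lipschitz.
have dbl (y : R) : y \in `]0, 1[ ->
    (y / 2 \in `]0, 1[) /\ ((y + 1) / 2 \in `]0, 1[).
  by rewrite !in_itv /= => /andP[y0 y1]; split; apply/andP; split; lra.
have [t1 t2] := dbl _ tI; have [s1 s2] := dbl _ sI.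
have := IH _ _ t1 s1; have := IH _ _ t2 s2.
rewrite expnS mul2n !cot_err_double -?in_itv//.
have -> : (t + 1) / 2 - (s + 1) / 2 = (t - s) / 2 by ring.
rewrite -!mulrBl !normrM (@ger0_norm _ 2^-1)// => h2 h1.
(* The gain of 1/2 comes from the halved arguments; averaging the two bounds keeps it. *)
apply: le_trans (_ : (4 * pi ^+ 2 / 2 ^+ n * (`|t - s| / 2) +
   4 * pi ^+ 2 / 2 ^+ n * (`|t - s| / 2)) / 2 <= _).
  rewrite ler_pM2r//; apply: le_trans (lerD h1 h2).
  apply: le_trans (ler_normD _ _); rewrite le_eqVlt; apply/predU1P; left.
  by congr (`| _ |); ring.
rewrite le_eqVlt; apply/predU1P; left; rewrite [2 ^+ n.+1]exprS.
have : 2 ^+ n != 0 :> R by rewrite expf_neq0.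
by move: (2 ^+ n) (4 * pi ^+ 2) `|t - s| => e C d e0; field; rewrite e0.
Qed.

Lemma cot_err_half (R : realType) (M : nat) : cot_err M (2^-1 : R) = 0.
Proof.
rewrite /cot_err /cot cos_pihalf mul0r mulr0 /cot_psum big1 ?subrr// => j _.
by apply/eqP; rewrite subr_eq0; apply/eqP; congr (_ + _)^-1; field.
Qed.

Lemma cot_psum_cvg (R : realType) (t : R) : 0 < t < 1 ->
  (cot_psum (2 ^ n) t @[n --> \oo] --> pi * cot (pi * t))%classic.
Proof.
move=> tI.
have errE n : cot_psum (2 ^ n) t = pi * cot (pi * t) - cot_err (2 ^ n) t.
  by rewrite /cot_err; ring.
rewrite -[pi * cot _]subr0; under eq_cvg do rewrite errE.
apply: cvgB; first exact: cvg_cst.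
apply: norm_cvg0.
apply: (@squeeze_cvgr _ _ _ _ (cst 0) (fun n => (4 * pi ^+ 2) * 2^-1 ^+ n)).
- apply: nearW => n; rewrite normr_ge0 /=.
  have tI' : t \in `]0, 1[ by rewrite in_itv.
  have hI : (2^-1 : R) \in `]0, 1[ by rewrite in_itv /=; lra.
  (* The error is compared with its value 0 at 1/2, whose distance to t is less than 1. *)
  have := cot_err_lipschitz n tI' hI.
  rewrite cot_err_half subr0 => h; apply: (le_trans h).
  rewrite exprVn ler_piMr ?divr_ge0 ?mulr_ge0 ?exprn_ge0 ?pi_ge0//.
  by move: tI => /andP[t0 t1]; rewrite ler_norml; apply/andP; split; lra.
- exact: cvg_cst.
- suff : ((4 * pi ^+ 2) * 2^-1 ^+ n @[n --> \oo] -->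
    4 * pi ^+ 2 * (0 : R))%classic.
    by rewrite mulr0.
  by apply: cvgMl_tmp; apply: cvg_expr; rewrite ger0_norm; lra.
Qed.

(** * Sums over residue classes *)

Lemma big_residue (V : nmodType) (N M r : nat) (F : nat -> V) : (r < N)%N ->
  \sum_(0 <= p < N * M | (p %% N == r)%N) F p = \sum_(j < M) F (r + N * j)%N.
Proof.
move=> rN; elim: M => [|M IH]; first by rewrite muln0 big_geq// big_ord0.
rewrite mulnS addnC (@big_cat_nat _ _ _ (N * M)%N) ?leq_addr//= IH big_ord_recr /=.
congr (_ + _).
rewrite -{1}[(N * M)%N]add0n big_addn addKn big_mkord.
rewrite (big_pred1 (Ordinal rN)) => [|i]; first by [].
by rewrite /= addnC mulnC modnMDl modn_small.
Qed.

Lemma big_nonzero_residue (V : nmodType) (N M r : nat) (F : nat -> V) :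
  (0 < r < N)%N ->
  \sum_(1 <= p < N * M | (p %% N == r)%N) F p = \sum_(j < M) F (r + N * j)%N.
Proof.
move=> /andP[r0 rN]; rewrite -big_residue//.
case: (posnP (N * M)) => [->|NM0]; first by rewrite !big_geq.
by rewrite [RHS]big_ltn_cond// mod0n (ltn_eqF r0).
Qed.

Definition inv_sum {R : realType} (P : pred nat) (X : nat) : R :=
  \sum_(1 <= p < X | P p) (p%:R)^-1.

(** With q = r mod N, the positive integers in the classes of r and -r are q + N j and N - q + N j;
    taking out N leaves the two terms of [cot_psum] at q / N. *)
Lemma inv_sum_residues (R : realType) (N M r : nat) :
  ~~ (N %| r)%N -> (0 < N)%N ->
  inv_sum (fun p => p == r %[mod N])%N (N * M) -
  inv_sum (fun p => N %| p + r)%N (N * M) =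
  cot_psum M ((r %% N)%:R / N%:R) / N%:R :> R.
Proof.
move=> Nr N0; set q := (r %% N)%N.
have q0 : (0 < q)%N by rewrite lt0n.
have qN : (q < N)%N by rewrite ltn_mod.
rewrite /inv_sum big_nonzero_residue ?q0//.
rewrite (eq_bigl (fun p => p %% N == N - q)%N) => [|p]; last first.
  rewrite /dvdn -modnDm -/q.
  have pN : (p %% N < N)%N by rewrite ltn_mod.
  apply/eqP/eqP => [E|->]; last by rewrite subnK ?modnn// ltnW.
  have : (N %| p %% N + q)%N by apply/eqP.
  (* Here 0 < p %% N + q < 2 N, so this multiple of N is N itself. *)
  case/dvdnP => -[|[|k]]; lia.
rewrite big_nonzero_residue; last lia.
rewrite -sumrB /cot_psum mulr_suml; apply: eq_bigr => j _.
have NR : 0 < N%:R :> R by rewrite ltr0n.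
have qR : 0 < q%:R :> R by rewrite ltr0n.
have qNR : q%:R < N%:R :> R by rewrite ltr_nat.
have jR : 0 <= j%:R :> R by [].
rewrite !natrD !natrM natrB 1?ltnW//.
field.
by rewrite !gt_eqF//=; nra.
Qed.

Lemma cot_natDpi (R : realType) (y : R) (n : nat) : cot (y + pi *+ n) = cot y.
Proof.
elim: n => [|n IH]; first by rewrite addr0.
by rewrite mulrSr addrA /cot sinDpi cosDpi invrN mulrNN.
Qed.

Lemma sin_natDpi_eq0 (R : realType) (y : R) (n : nat) :
  (sin (y + pi *+ n) == 0) = (sin y == 0).
Proof.
elim: n => [|n IH]; first by rewrite addr0.
by rewrite mulrSr addrA sinDpi oppr_eq0.
Qed.

Lemma pi_div_mod (R : realType) (N r : nat) : (0 < N)%N ->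
  pi * r%:R / N%:R = pi * ((r %% N)%:R / N%:R) + pi *+ (r %/ N) :> R.
Proof.
move=> N0; have NR : N%:R != 0 :> R by rewrite pnatr_eq0 -lt0n.
rewrite {1}(divn_eq r N) addnC natrD natrM -[pi *+ _]mulr_natr.
by move: (pi) => p; field.
Qed.

Lemma frac_mod_itv (R : realType) (N r : nat) : ~~ (N %| r)%N -> (0 < N)%N ->
  0 < ((r %% N)%:R / N%:R : R) < 1.
Proof.
move=> Nr N0.
have NR : 0 < N%:R :> R by rewrite ltr0n.
by rewrite divr_gt0//= ?ltr0n ?lt0n// ltr_pdivrMr// mul1r ltr_nat ltn_mod.
Qed.

Lemma sin_pi_nat_neq0 (R : realType) (N r : nat) : ~~ (N %| r)%N -> (0 < N)%N ->
  sin (pi * r%:R / N%:R : R) != 0.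
Proof.
by move=> Nr N0; rewrite pi_div_mod// sin_natDpi_eq0 sin_pi_neq0// frac_mod_itv.
Qed.

Lemma inv_sum_residues_cvg (R : realType) (N r : nat) :
  ~~ (N %| r)%N -> (0 < N)%N ->
  (inv_sum (fun p => p == r %[mod N])%N (N * 2 ^ n) -
   inv_sum (fun p => N %| p + r)%N (N * 2 ^ n) @[n --> \oo] -->
   (pi / N%:R * cot (pi * r%:R / N%:R) : R))%classic.
Proof.
move=> Nr N0.
under eq_cvg do rewrite inv_sum_residues//.
have -> : pi / N%:R * cot (pi * r%:R / N%:R) =
   pi * cot (pi * ((r %% N)%:R / N%:R)) / N%:R :> R.
  by rewrite pi_div_mod// cot_natDpi mulrAC.
by apply: cvgMr_tmp; apply: cot_psum_cvg; exact: frac_mod_itv.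
Qed.

(** The difference has at most [l] terms, each at most 1 / (N 2^n) <= 2^-n. *)
Lemma inv_sum_shift_cvg (R : realType) (P : pred nat) (l N : nat) :
  (0 < N)%N ->
  (inv_sum P (N * 2 ^ n + l) - inv_sum P (N * 2 ^ n) @[n --> \oo] -->
   (0 : R))%classic.
Proof.
move=> N0.
apply: (@squeeze_cvgr _ _ _ _ (cst 0) (fun n => l%:R * (2^-1 ^+ n : R))).
- apply: nearW => n; rewrite /inv_sum.
  have X0 : (0 < N * 2 ^ n)%N by rewrite muln_gt0 N0 expn_gt0.
  rewrite (@big_cat_nat _ _ _ (N * 2 ^ n)%N) ?leq_addr//= addrAC subrr add0r.
  apply/andP; split; first by apply: sumr_ge0 => p _; rewrite invr_ge0.
  apply: (@le_trans _ _ (\sum_(N * 2 ^ n <= p < N * 2 ^ n + l) (2^-1 ^+ n : R))).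
    rewrite big_mkcond; apply: ler_sum_nat => p /andP[Xp _].
    case: ifP => _; last by rewrite exprn_ge0.
    have p0 : (0 < p)%N by exact: leq_trans X0 Xp.
    rewrite exprVn lef_pV2 ?posrE ?exprn_gt0 ?ltr0n//.
    by rewrite -natrX ler_nat; apply: leq_trans Xp; rewrite leq_pmull.
  by rewrite sumr_const_nat addKn mulr_natl.
- exact: cvg_cst.
- suff : (l%:R * 2^-1 ^+ n @[n --> \oo] --> l%:R * (0 : R))%classic.
    by rewrite mulr0.
  by apply: cvgMl_tmp; apply: cvg_expr; rewrite ger0_norm; lra.
Qed.

(** * Telescoping along rows and diagonals *)

Lemma inv_sumS (R : realType) (P : pred nat) (l : nat) : (0 < l)%N ->
  inv_sum P l.+1 = inv_sum P l + (if P l then l%:R^-1 else 0) :> R.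
Proof.
by move=> l0; rewrite /inv_sum big_mkcond big_nat_recr//= -big_mkcond.
Qed.

Definition row_psum {R : realType} (P : pred nat) (l X : nat) : R :=
  \sum_(1 <= m < X | P m) (m%:R * (m + l)%:R)^-1.

(** Since l / (m (m + l)) = 1/m - 1/(m + l), the second part, reindexed by p = m + l, runs over l <
    p < X + l in the class [Q]. *)
Lemma row_psumE (R : realType) (P Q : pred nat) (l X : nat) :
  (0 < l)%N -> (0 < X)%N -> (forall m, P m = Q (m + l)%N) ->
  l%:R * row_psum P l X =
    inv_sum P X - (inv_sum Q (X + l) - inv_sum Q l.+1) :> R.
Proof.
move=> l0 X0 PQ.
have -> : inv_sum Q (X + l) - inv_sum Q l.+1 =
    \sum_(1 <= m < X | P m) ((m + l)%:R)^-1 :> R.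
  rewrite /inv_sum -add1n (@big_cat_nat _ _ _ (1 + l)%N 1 (X + l)%N)//=; last first.
    by rewrite leq_add2r.
  rewrite addrAC subrr add0r big_addn addnK.
  by apply: eq_bigl => m; rewrite PQ.
rewrite /inv_sum -sumrB /row_psum mulr_sumr.
rewrite [LHS]big_nat_cond [RHS]big_nat_cond.
apply: eq_bigr => m /andP[/andP[m0 _] _].
have mR : 0 < m%:R :> R by rewrite ltr0n.
have lR : 0 < l%:R :> R by rewrite ltr0n.
by rewrite natrD; field; rewrite !gt_eqF//=; lra.
Qed.

Lemma row_psum_cvg (R : realType) (P : pred nat) (l : nat) : (0 < l)%N ->
  cvgn (row_psum P l : nat -> R).
Proof.
move=> l0; apply: nondecreasing_is_cvgn.
- apply/nondecreasing_seqP => X; rewrite /row_psum.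
  case: X => [|X]; first by rewrite !big_geq.
  rewrite [leRHS]big_mkcond big_nat_recr//= -big_mkcond lerDl.
  by case: ifP => // _; rewrite invr_ge0 mulr_ge0.
exists 1 => _ [X _ <-]; rewrite /row_psum.
case: X => [|X]; first by rewrite big_geq.
(* As l >= 1, each term is at most 1 / (m (m + 1)), whose sum over 1 <= m < Y is 1 - 1/Y. *)
apply: (@le_trans _ _ (1 - X.+1%:R^-1)); last by rewrite gerBl invr_ge0.
elim: X => [|X IH]; first by rewrite big_geq// invr1 subrr.
rewrite big_mkcond big_nat_recr//= -big_mkcond.
have X0 : 0 <= X%:R :> R by [].
have l1 : 1 <= l%:R :> R by rewrite ler1n.
apply: le_trans (lerD IH (_ : _ <= (X.+1%:R * X.+2%:R)^-1)) _.
  case: ifP => _; last by rewrite invr_ge0 mulr_ge0.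
  rewrite lef_pV2 ?posrE ?mulr_gt0 ?ltr0n ?addSn//.
  by rewrite ler_wpM2l// ler_nat ltnS -addn1 leq_add2l.
rewrite -(addn1 X.+1) -(addn1 X) !natrD.
rewrite le_eqVlt; apply/predU1P; left; field.
by apply/andP; split; rewrite gt_eqF//; lra.
Qed.

Definition mid_sum {R : realType} (P : pred nat) (l : nat) : R :=
  \sum_(1 <= n < l | P n) (n%:R * (l - n)%:R)^-1.

(** Here l / (n (l - n)) = 1/n + 1/(l - n), and the reflection n -> l - n carries [P] to [Q]. *)
Lemma mid_sumE (R : realType) (P Q : pred nat) (l : nat) :
  (0 < l)%N -> (forall n, (0 < n < l)%N -> P n = Q (l - n)%N) ->
  l%:R * mid_sum P l = inv_sum P l + inv_sum Q l :> R.
Proof.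
move=> l0 PQ.
have -> : inv_sum Q l = \sum_(1 <= n < l | P n) ((l - n)%:R)^-1 :> R.
  rewrite /inv_sum big_nat_rev/= [LHS]big_nat_cond [RHS]big_nat_cond.
  apply: congr_big => // n.
    case nI: (1 <= n < l)%N => //=; rewrite add1n subSS PQ//.
rewrite /inv_sum -big_split /= /mid_sum mulr_sumr.
rewrite [LHS]big_nat_cond [RHS]big_nat_cond; apply: eq_bigr => n /andP[/andP[n0 nl] _].
rewrite natrB 1?ltnW//.
have nR : 0 < n%:R :> R by rewrite ltr0n.
have nlR : n%:R < l%:R :> R by rewrite ltr_nat.
field; rewrite !gt_eqF//=; lra.
Qed.

Definition res_eq (N r : nat) : pred nat := fun p => (p == r %[mod N])%N.
Definition res_neg (N r : nat) : pred nat := fun p => (N %| p + r)%N.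

(* The sum of [1 / (m (m + l))] over the integers [m = l (mod N)], [m <> 0, -l]. *)
Definition row_total {R : realType} (N l : nat) : R :=
  limn (row_psum (res_eq N l) l) + limn (row_psum (res_neg N l.*2) l) -
  mid_sum (res_neg N l) l.

(** Shifting by l sends the class of l to that of 2 l and the class of -2 l to that of -l; the
    reflection n -> l - n sends -l to 2 l. The sums below l cancel against the diagonal, and only
    the terms at p = l survive, twice 1/l when N divides l. The last two differences tend to 0. *)
Lemma row_psum_telescope (R : realType) (N l X : nat) :
  odd N -> (0 < l)%N -> (0 < X)%N ->
  l%:R * (row_psum (res_eq N l) l X + row_psum (res_neg N l.*2) l X -
    mid_sum (res_neg N l) l) =
  (if (N %| l)%N then 2 / l%:R else 0)
  + (inv_sum (res_eq N l) X - inv_sum (res_neg N l) X)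
  - (inv_sum (res_eq N l.*2) X - inv_sum (res_neg N l.*2) X)
  - (inv_sum (res_eq N l.*2) (X + l) - inv_sum (res_eq N l.*2) X)
  - (inv_sum (res_neg N l) (X + l) - inv_sum (res_neg N l) X) :> R.
Proof.
move=> oN l0 X0; rewrite mulrBr mulrDr.
rewrite (@row_psumE _ _ (res_eq N l.*2))//; last first.
  by move=> m; rewrite /res_eq -addnn eqn_modDr.
rewrite (@row_psumE _ _ (res_neg N l))//; last first.
  by move=> m; rewrite /res_neg -addnn addnA.
rewrite (@mid_sumE _ _ (res_eq N l.*2))//; last first.
  move=> n /andP[n0 nl]; rewrite /res_neg /res_eq -(eqn_modDr n) subnK 1?ltnW//.
  by rewrite eq_sym eqn_mod_dvd; [congr (_ %| _)%N; lia | lia].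
rewrite !inv_sumS//.
(* Oddness enters here: N divides 2 l only if it divides l. *)
have -> : res_neg N l l = (N %| l)%N.
  by rewrite /res_neg addnn -mul2n Gauss_dvdr// coprime_sym coprime2n.
have -> : res_eq N l.*2 l = (N %| l)%N.
  by rewrite /res_eq -addnn -{1}[l]add0n eqn_modDr mod0n eq_sym.
case: ifP => _; ring.
Qed.

(** The rows converge, so their limits may be taken along X = N 2^n, where the cotangent series is
    known; the telescoped form gives a second limit of the same sequence. *)
Lemma row_total_eq (R : realType) (N l : nat) : odd N -> (0 < l)%N ->
  row_total N l =
  if (N %| l)%N then 2 / l%:R ^+ 2
  else pi / N%:R / (sin (2 * l%:R * pi / N%:R) * l%:R) :> R.
Proof.
move=> oN l0.
have N0 : (0 < N)%N by case: (N) oN.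
have lR : l%:R != 0 :> R by rewrite pnatr_eq0 -lt0n.
pose X n := (N * 2 ^ n)%N.
have Xy : (X n @[n --> \oo] --> \oo)%classic.
  apply/cvgnyPge => A; exists A => // n /= An.
  apply: (leq_trans An); apply: (@leq_trans (2 ^ n)); last exact: leq_pmull.
  exact/ltnW/ltn_expl.
have X0 n : (0 < X n)%N by rewrite muln_gt0 N0 expn_gt0.
have dvd2 : (N %| l.*2)%N = (N %| l)%N.
  by rewrite -mul2n Gauss_dvdr// coprimen2.
pose v : R := if (N %| l)%N then 0 else
  pi / N%:R * (cot (pi * l%:R / N%:R) - cot (pi * (l.*2)%:R / N%:R)).
have cv : ((inv_sum (res_eq N l) (X n) - inv_sum (res_neg N l) (X n)) -
    (inv_sum (res_eq N l.*2) (X n) - inv_sum (res_neg N l.*2) (X n))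
    @[n --> \oo] --> v)%classic.
  rewrite /v; case: ifPn => Nl.
    (* The classes of r and -r coincide when N divides r, so no cotangent appears. *)
    have E r Y : (N %| r)%N ->
        inv_sum (res_eq N r) Y = inv_sum (res_neg N r) Y :> R.
      move=> Nr; apply: eq_bigl => p.
      by rewrite /res_eq /res_neg dvdn_addl// /dvdn (eqP Nr).
    have Nl2 : (N %| l.*2)%N by rewrite dvd2.
    under eq_cvg do rewrite !E// !subrr.
    exact: cvg_cst.
  rewrite mulrBr.
  by apply: cvgB; apply: inv_sum_residues_cvg => //; rewrite dvd2.
have lim1 : (l%:R * (row_psum (res_eq N l) l (X n) +
      row_psum (res_neg N l.*2) l (X n) - mid_sum (res_neg N l) l)
    @[n --> \oo] --> (l%:R * row_total N l : R))%classic.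
  have c1 := cvg_comp _ _ Xy (@row_psum_cvg R (res_eq N l) l l0).
  have c2 := cvg_comp _ _ Xy (@row_psum_cvg R (res_neg N l.*2) l l0).
  have c3 : (mid_sum (res_neg N l) l @[n --> \oo] -->
      (mid_sum (res_neg N l) l : R))%classic.
    exact: cvg_cst.
  have c4 : (row_psum (res_eq N l) l (X n) +
      row_psum (res_neg N l.*2) l (X n) - mid_sum (res_neg N l) l
    @[n --> \oo] --> (row_total N l : R))%classic.
    by apply: cvgB c3; exact: cvgD c1 c2.
  exact: cvgMl_tmp c4.
have lim2 : (l%:R * (row_psum (res_eq N l) l (X n) +
      row_psum (res_neg N l.*2) l (X n) - mid_sum (res_neg N l) l)
    @[n --> \oo] --> ((if (N %| l)%N then 2 / l%:R else 0) + v - 0 - 0 : R))%classic.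
  under eq_cvg do rewrite row_psum_telescope//.
  apply: cvgB; last exact: inv_sum_shift_cvg.
  apply: cvgB; last exact: inv_sum_shift_cvg.
  under eq_cvg do rewrite -addrA.
  by apply: cvgD => //; exact: cvg_cst.
have /(canRL (mulKf lR)) -> : l%:R * row_total N l =
    (if (N %| l)%N then 2 / l%:R else 0) + v - 0 - 0.
  by apply: cvg_unique lim1 lim2.
rewrite !subr0 /v; case: ifPn => Nl.
  by rewrite addr0; field.
rewrite add0r.
have NR : N%:R != 0 :> R by rewrite pnatr_eq0 -lt0n.
set u : R := pi * l%:R / N%:R.
have -> : pi * (l.*2)%:R / N%:R = u + u by rewrite -addnn natrD /u; ring.
have -> : 2 * l%:R * pi / N%:R = u + u by rewrite /u; ring.
have su : sin u != 0 by exact: sin_pi_nat_neq0.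
have suu : sin (u + u) != 0.
  have -> : u + u = pi * (l.*2)%:R / N%:R by rewrite -addnn natrD /u; ring.
  by apply: sin_pi_nat_neq0 => //; rewrite dvd2.
have -> : cot u - cot (u + u) = (sin (u + u))^-1.
  apply: (mulIf su); apply: (mulIf suu).
  have -> : (cot u - cot (u + u)) * sin u * sin (u + u) =
      sin (u + u) * cos u - cos (u + u) * sin u.
    by rewrite /cot; field; rewrite su suu.
  by rewrite -sinB addrK mulrAC mulVf// mul1r.
move: (pi) (sin (u + u)) suu => p s s0; field.
by rewrite lR NR s0.
Qed.

(** * Unordered sums of complex families *)

Section exhaustion.
Variable I : choiceType.

(** An unordered sum can be computed along any such sequence of lists; this allows one double series
    to be arranged by boxes and another by diagonals. *)
Definition exhausts (s : nat -> seq I) :=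
  (forall n, uniq (s n)) /\ forall i, \forall n \near \oo%classic, i \in s n.

Lemma exhausts_totally (s : nat -> seq I) : exhausts s ->
  ([fset i in s n]%fset @[n --> \oo] --> totally)%classic.
Proof.
move=> [us se] P /= [A _ AP].
(* [A] is finite, so its elements eventually all lie in [s n] together. *)
have : \forall n \near \oo%classic, forall i : A, val i \in s n.
  by apply: filter_forall => i; exact: se.
apply: filterS => n sn; apply: AP => /=.
by apply/fsubsetP => i iA; rewrite inE /=; exact: (sn [` iA]%fset).
Qed.

Lemma partial_sum_seq (V : zmodType) (u : I -> V) (s : seq I) : uniq s ->
  partial_sum u [fset i in s]%fset = \sum_(i <- s) u i.
Proof.
move=> us; rewrite /partial_sum -(big_seq_fsetE _ _ xpredT u)/=.
by apply: perm_big; apply: uniq_perm => // i; rewrite inE.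
Qed.

Lemma partial_sum_exhausts (K : numFieldType) (V : normedModType K)
    (u : I -> V) (S : V) (s : nat -> seq I) :
  exhausts s -> (partial_sum u @ totally --> S)%classic ->
  ((\sum_(i <- s n) u i) @[n --> \oo] --> S)%classic.
Proof.
move=> es uS.
have := cvg_comp _ _ (exhausts_totally es) uS.
have -> : partial_sum u \o (fun n => [fset i in s n]%fset) =
          (fun n => \sum_(i <- s n) u i).
  by apply/funext => n /=; rewrite partial_sum_seq//; case: es.
exact.
Qed.

Lemma partial_sum_le (R : numDomainType) (u : I -> R) (A B : {fset I}) :
  (forall i, 0 <= u i) -> (A `<=` B)%fset ->
  partial_sum u A <= partial_sum u B.
Proof.
move=> u0 /fsubsetP AB.
rewrite /partial_sum -!(big_seq_fsetE _ _ xpredT u)/=.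
rewrite [leRHS](big_fsetID _ (mem A))/=.
have -> : [fset x in B | x \in A]%fset = A.
  apply/fsetP => i; rewrite !inE /=.
  by case: (boolP (i \in A)) => [/AB ->|]; rewrite ?andbF.
by rewrite lerDl sumr_ge0.
Qed.

(** Every finite set lies in some [s n], so [M] bounds all finite partial sums; by monotonicity they
    converge to their supremum. *)
Lemma cvg_partial_sum_ge0 (R : realType) (u : I -> R) (s : nat -> seq I) (M : R) :
  exhausts s -> (forall i, 0 <= u i) ->
  (forall n, \sum_(i <- s n) u i <= M) ->
  cvg (partial_sum u @ totally)%classic.
Proof.
move=> es u0 uM.
have bound A : partial_sum u A <= M.
  have tA : totally [set B : {fset I} | (A `<=` B)%fset]%classic by exists A.
  have [n _ /(_ n (leqnn n)) /= An] := exhausts_totally es tA.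
  apply: le_trans (partial_sum_le u0 An) _.
  by rewrite partial_sum_seq//; case: es.
pose E : set R := range (partial_sum u).
have hE : has_sup E.
  split; first by exists (partial_sum u fset0), fset0.
  by exists M => _ [A _ <-].
apply/cvg_ex; exists (sup E); apply/cvgrPdist_le => e e0.
have [_ [A _ <-] lt_e] := sup_adherent e0 hE.
exists A => // B /= AB.
have := partial_sum_le u0 AB.
have : partial_sum u B <= sup E by apply: ub_le_sup; [case: hE | exists B].
move=> h1 h2; rewrite ger0_norm; lra.
Qed.

End exhaustion.

Section complex_limits.
Variable R : realType.

Lemma ReD (x y : R[i]) : complex.Re (x + y) = complex.Re x + complex.Re y.
Proof. by case: x; case: y. Qed.

Lemma ImD (x y : R[i]) : complex.Im (x + y) = complex.Im x + complex.Im y.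
Proof. by case: x; case: y. Qed.

Lemma normc_le_ReIm (z : R[i]) :
  `|z| <= (`|complex.Re z| + `|complex.Im z|)%:C%C.
Proof.
rewrite normc_def lecR -(@ler_pXn2r _ 2)// ?nnegrE ?sqrtr_ge0 ?addr_ge0//.
rewrite sqr_sqrtr ?addr_ge0 ?sqr_ge0// sqrrD !real_normK ?num_real//.
by rewrite addrAC lerDl mulrn_wge0// mulr_ge0.
Qed.

Lemma cvg_complex (T : Type) (F : set_system T) {FF : Filter F}
    (f : T -> R[i]^o) (a b : R) :
  (complex.Re (f t) @[t --> F] --> a)%classic ->
  (complex.Im (f t) @[t --> F] --> b)%classic ->
  (f t @[t --> F] --> (Complex a b : R[i]^o))%classic.
Proof.
move=> fa fb; apply/cvgrPdist_lt => e; rewrite ltcE => /andP[/eqP eI e0].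
(* A positive element of [R[i]] is real, so half of its real part can be allotted to each
   coordinate. *)
have e2 : 0 < complex.Re e / 2 by rewrite divr_gt0.
have /cvgrPdist_lt/(_ _ e2) := fa; have /cvgrPdist_lt/(_ _ e2) := fb.
apply: filterS2 => t h1 h2.
apply: le_lt_trans (normc_le_ReIm _) _.
rewrite ltcE eI /= eqxx /=.
case: (f t) h1 h2 => x y /= h1 h2; lra.
Qed.

Lemma cvg_real_complex (T : Type) (F : set_system T) {FF : Filter F}
    (f : T -> R) (a : R) :
  (f t @[t --> F] --> a)%classic ->
  (((f t)%:C%C : R[i]^o) @[t --> F] --> (a%:C%C : R[i]^o))%classic.
Proof. by move=> fa; apply: cvg_complex => //=; exact: cvg_cst. Qed.

Lemma cvg_partial_sum_dominated (I : choiceType) (u : I -> R[i]^o) (h : I -> R)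
    (s : nat -> seq I) (M : R) :
  exhausts s -> (forall i, `|u i| <= (h i)%:C%C) ->
  (forall n, \sum_(i <- s n) h i <= M) ->
  cvg (partial_sum u @ totally)%classic.
Proof.
move=> es uh hM.
have h0 i : 0 <= h i by rewrite -ler0c (le_trans _ (uh i)).
(* For a real coordinate p, the family p u + h is nonnegative with partial sums at most 2 M;
   subtracting h recovers p u. *)
have part (p : R[i] -> R) : (forall x y, p (x + y) = p x + p y) -> p 0 = 0 ->
    (forall z, `|p z|%:C%C <= `|z|) ->
    cvg ((p \o partial_sum u) @ totally)%classic.
  move=> pD p0 pn.
  have ph i : `|p (u i)| <= h i by rewrite -lecR (le_trans (pn _)).
  have c1 : cvg (partial_sum (fun i => p (u i) + h i) @ totally)%classic.
    apply: (@cvg_partial_sum_ge0 _ _ _ s (M + M)) => // [i|n].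
      by have := ph i; rewrite ler_norml; lra.
    apply: le_trans (lerD (hM n) (hM n)); rewrite -big_split /=.
    apply: ler_sum => i _; rewrite lerD2r.
    by have := ph i; rewrite ler_norml; lra.
  have c2 : cvg (partial_sum h @ totally)%classic.
    exact: (@cvg_partial_sum_ge0 _ _ _ s M).
  have -> : p \o partial_sum u =
      partial_sum (fun i => p (u i) + h i) \- partial_sum h.
    apply/funext => A; rewrite /partial_sum /= (big_morph p pD p0) -sumrB.
    by apply: eq_bigr => i _; rewrite addrK.
  exact: is_cvgB.
have cR := part (@complex.Re R) ReD erefl (@normc_ge_Re R).
have cI : cvg ((@complex.Im R \o partial_sum u) @ totally)%classic.
  apply: part => //; first exact: ImD.
  move=> [a b] /=; rewrite normc_def lecR /= -sqrtr_sqr.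
  by rewrite ler_wsqrtr// lerDr sqr_ge0.
apply/cvg_ex; eexists; apply: cvg_complex; [exact: cR | exact: cI].
Qed.
End complex_limits.

(** * Double sums by boxes, diagonals and rows, and their domination *)

Definition box (M K : nat) : seq (nat * nat) :=
  [seq (m, n) | n <- index_iota 0 K, m <- index_iota 0 M].

(** Ordered by l = m + n. Pairs with a zero coordinate are included, since [dterm] vanishes
    there. *)
Definition diagonals (K : nat) : seq (nat * nat) :=
  [seq ((l - n)%N, n) | l <- index_iota 0 K, n <- index_iota 0 l.+1].

Lemma index_iota_exhausts : exhausts (index_iota 0).
Proof.
split=> [n|i]; first exact: iota_uniq.
by exists i.+1 => // n /= ni; rewrite mem_index_iota.
Qed.

Lemma mem_box M K p : (p \in box M K) = (p.1 < M)%N && (p.2 < K)%N.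
Proof.
apply/allpairsPdep/andP => [[n] [m] [nI mI ->]|[pM pK]].
  by move: nI mI; rewrite !mem_index_iota.
by exists p.2, p.1; rewrite !mem_index_iota; split => //; case: p {pM pK}.
Qed.

Lemma uniq_box M K : uniq (box M K).
Proof.
apply: allpairs_uniq_dep => [|n _|]; try exact: iota_uniq.
by move=> [n m] [n' m'] _ _ /= [-> ->].
Qed.

Lemma box_exhausts : exhausts (fun n => box n n).
Proof.
split=> [n|p]; first exact: uniq_box.
by exists (maxn p.1 p.2).+1 => // n /= pn; rewrite mem_box -gtn_max.
Qed.

Lemma diagonals_exhausts : exhausts diagonals.
Proof.
split=> [n|p].
  apply: allpairs_uniq_dep => [|l _|]; try exact: iota_uniq.
  move=> [l n1] [l' n2] /allpairsPdep[x [y [_ yI [-> ->]]]].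
  move=> /allpairsPdep[x' [y' [_ yI' [-> ->]]]] /= [].
  move: yI yI'; rewrite !mem_index_iota => yI yI' E1 E2.
  by rewrite -E2 in yI' E1 *; have -> : x = x' by lia.
exists (p.1 + p.2).+1 => // n /= pn.
apply/allpairsPdep; exists (p.1 + p.2)%N, p.2; rewrite !mem_index_iota.
by split; [exact: pn | rewrite ltnS leq_addl | rewrite addnK; case: p {pn}].
Qed.

Lemma big_box (V : zmodType) (f : nat * nat -> V) M K :
  \sum_(p <- box M K) f p = \sum_(0 <= n < K) \sum_(0 <= m < M) f (m, n).
Proof. by rewrite big_allpairs_dep. Qed.

Lemma big_diagonals (V : zmodType) (f : nat * nat -> V) K :
  \sum_(p <- diagonals K) f p =
  \sum_(0 <= l < K) \sum_(0 <= n < l.+1) f ((l - n)%N, n).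
Proof. by rewrite big_allpairs_dep. Qed.

(** Every box containing a suitable finite set has its sum within e/2 of S. With the number X of
    rows fixed, letting their length grow replaces each row by its limit. *)
Lemma partial_sum_rows (K : numFieldType) (V : normedModType K)
    (f : nat * nat -> V) (S : V) (r : nat -> V) :
  (partial_sum f @ totally --> S)%classic ->
  (forall n, \sum_(0 <= m < M) f (m, n) @[M --> \oo] --> r n)%classic ->
  (\sum_(0 <= n < X) r n @[X --> \oo] --> S)%classic.
Proof.
move=> fS fr; apply/cvgrPdist_lt => e e0.
have e2 : 0 < e / 2 by rewrite divr_gt0.
have [A _ AS] : totally [set B | `|S - partial_sum f B| < e / 2]%classic.
  by have /cvgrPdist_lt := fS; exact.
have tA : totally [set B : {fset nat * nat} | (A `<=` B)%fset]%classic by exists A.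
have [n0 _ /(_ n0 (leqnn n0)) /= An0] := exhausts_totally box_exhausts tA.
exists n0 => // X /= n0X.
have : (\sum_(0 <= n < X) \sum_(0 <= m < M) f (m, n) @[M --> \oo] -->
    \sum_(0 <= n < X) r n)%classic.
  apply: (@cvg_big V nat _ 0 xpredT) => // z; exact: add_continuous.
move=> /cvgrPdist_lt/(_ _ e2) [M0 _ M0M].
(* This length makes the box both contain [A] and come within e/2 of the sum of the row limits. *)
have := M0M (maxn M0 n0) (leq_maxl _ _).
have : `|S - partial_sum f [fset p in box (maxn M0 n0) X]%fset| < e / 2.
  apply: AS => /=; apply: (fsubset_trans An0).
  apply/fsubsetP => p; rewrite !inE /= !mem_box => /andP[p1 p2].
  by rewrite (leq_trans p1) ?leq_maxr//= (leq_trans p2).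
rewrite partial_sum_seq ?uniq_box// big_box.
set B := \sum_(0 <= n < X) \sum_(_ <= _ < _) _ => h1 h2.
rewrite (splitr e) -[S](subrK B) -addrA.
apply: le_lt_trans (ler_normD _ _) _.
by rewrite ltrD// distrC.
Qed.

(* [n^(-3/2)]: the convergence of its series is elementary and [wt m * wt n]
   dominates all six families. It is [0] at [n = 0]. *)
Definition wt {R : realType} (n : nat) : R := (n%:R * Num.sqrt n%:R)^-1.

Lemma sum_wt_le (R : realType) (n : nat) : \sum_(0 <= i < n) wt i <= 3 :> R.
Proof.
case: n => [|n]; first by rewrite big_geq.
rewrite big_ltn// {1}/wt mul0r invr0 add0r.
case: n => [|n]; first by rewrite big_geq.
(* Comparison with the integral of t^(-3/2); equality holds when the only nonzero term is [wt 1] =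
   1. *)
apply: (@le_trans _ _ (3 - 2 / Num.sqrt n.+1%:R)); last first.
  by rewrite gerBl divr_ge0 ?sqrtr_ge0.
elim: n => [|n IH]; first by rewrite big_nat1 /wt sqrtr1; lra.
rewrite big_nat_recr//= /wt.
apply: le_trans (lerD IH (lexx _)) _.
have : (Num.sqrt n.+1%:R) ^+ 2 = n.+1%:R :> R by rewrite sqr_sqrtr.
have : (Num.sqrt n.+2%:R) ^+ 2 = n.+2%:R :> R by rewrite sqr_sqrtr.
have : Num.sqrt n.+1%:R <= Num.sqrt n.+2%:R :> R by rewrite ler_wsqrtr// ler_nat.
have : 0 < Num.sqrt n.+1%:R :> R by rewrite sqrtr_gt0 ltr0n.
have : n.+2%:R = n.+1%:R + 1 :> R by rewrite -natr1.
move: (n.+1%:R) (n.+2%:R) (Num.sqrt n.+1%:R) (Num.sqrt n.+2%:R).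
move=> N N' s t -> s0 st tE sE.
have t0 : 0 < t by lra.
(* As t^2 - s^2 = 1, the difference 2/s - 2/t is 2 / (s t (s + t)), which is at least 1 / t^3
   because s <= t. *)
have -> : 2 / s = 2 / t + 2 / (s * t * (s + t)).
  have E : t ^+ 2 - s ^+ 2 = 1 by rewrite sE tE; ring.
  have -> : 2 / (s * t * (s + t)) = 2 * (t ^+ 2 - s ^+ 2) / (s * t * (s + t)).
    by rewrite E mulr1.
  by field; rewrite !gt_eqF//= addr_gt0.
suff : (t ^+ 2 * t)^-1 <= 2 / (s * t * (s + t)) by rewrite tE; lra.
rewrite ler_pdivlMr ?mulr_gt0 ?addr_gt0// mulrC ler_pdivrMr ?mulr_gt0 ?exprn_gt0//.
have : s * t <= t * t by rewrite ler_pM2r.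
have : s * s <= t * t by apply: ler_pM => //; lra.
nra.
Qed.

Lemma sum_wt_box_le (R : realType) (n : nat) :
  \sum_(p <- box n n) (wt p.1 * wt p.2) <= 9 :> R.
Proof.
rewrite big_box /=.
under eq_bigr => j _ do rewrite -mulr_suml.
rewrite -mulr_sumr.
have w0 : 0 <= \sum_(0 <= i < n) wt i :> R.
  by apply: sumr_ge0 => i _; rewrite invr_ge0 mulr_ge0 ?sqrtr_ge0.
have := @sum_wt_le R n.
have -> : 9 = 3 * 3 :> R by ring.
by move=> h; apply: ler_pM.
Qed.

(** One factor m + n is at least m, the other at least sqrt (m n) by the arithmetic-geometric mean
    inequality. *)
Lemma inv_cube_le_wt (R : realType) (m n : nat) : (0 < m)%N -> (0 < n)%N ->
  (n%:R * (m + n)%:R ^+ 2)^-1 <= wt m * wt n :> R.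
Proof.
move=> m0 n0; rewrite /wt -invfM.
have mR : 0 < m%:R :> R by rewrite ltr0n.
have nR : 0 < n%:R :> R by rewrite ltr0n.
have sm : 0 < Num.sqrt m%:R :> R by rewrite sqrtr_gt0.
have sn : 0 < Num.sqrt n%:R :> R by rewrite sqrtr_gt0.
rewrite lef_pV2 ?posrE ?mulr_gt0 ?exprn_gt0 ?ltr0n ?addn_gt0 ?m0//.
have -> : m%:R * Num.sqrt m%:R * (n%:R * Num.sqrt n%:R) =
  n%:R * (m%:R * (Num.sqrt m%:R * Num.sqrt n%:R)) :> R by ring.
rewrite ler_pM2l// natrD expr2; apply: ler_pM; [lra|nra|lra|].
have := sqr_ge0 (Num.sqrt m%:R - Num.sqrt n%:R : R).
by rewrite sqrrB !sqr_sqrtr; lra.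
Qed.

(** The condition on [q] is shared by the six families: each denominator has a factor m or n and at
    least two factors m + n. *)
Lemma norm_term_le (R : realType) (x : R[i]) (j m n q : nat) :
  `|x| <= 1 -> (0 < m)%N -> (0 < n)%N -> (minn m n * (m + n) ^ 2 <= q)%N ->
  `|x ^+ j / q%:R| <= (wt m * wt n)%:C%C.
Proof.
move=> x1 m0 n0 mnq.
rewrite normrM normfV normr_nat normrX.
apply: (@le_trans _ _ (q%:R^-1));
  first by rewrite ler_piMl ?invr_ge0// exprn_ile1.
have -> : q%:R^-1 = (q%:R^-1 : R)%:C%C by rewrite fmorphV rmorph_nat.
rewrite lecR.
have q0 : (0 < minn m n * (m + n) ^ 2)%N.
  by rewrite muln_gt0 leq_min m0 n0 expn_gt0 addn_gt0 m0.
apply: (@le_trans _ _ (((minn m n * (m + n) ^ 2)%N)%:R^-1)).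
  by rewrite lef_pV2 ?posrE ?ltr0n ?ler_nat// (leq_trans q0).
rewrite natrM natrX; case: leqP => _; last exact: inv_cube_le_wt.
by rewrite [in X in X <= _]addnC [leRHS]mulrC; exact: inv_cube_le_wt.
Qed.

Lemma dsummable_dominated (R : realType) (D : rel nat) (a : nat -> nat -> R[i]) :
  (forall m n, (0 < m)%N -> (0 < n)%N -> `|a m n| <= (wt m * wt n)%:C%C) ->
  dsummable D a.
Proof.
move=> aw; apply: (@cvg_partial_sum_dominated _ _ _ (fun p => wt p.1 * wt p.2) _ 9).
- exact: box_exhausts.
- move=> [m n]; rewrite /dterm /=; case: ifP => [/and3P[m0 n0 _]|_]; first exact: aw.
  by rewrite normr0 ler0c mulr_ge0// invr_ge0 mulr_ge0 ?sqrtr_ge0.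
- exact: sum_wt_box_le.
Qed.

(** * Partial fractions, and the limits along rows and diagonals *)

Lemma partial_fractions (F : fieldType) (k : nat) (u v : F) :
  u != 0 -> v != 0 -> v + u != 0 ->
  \sum_(1 <= nu < k.+1) (u ^+ nu * (v + u) ^+ (k + 2 - nu))^-1 +
    (v * (v + u) ^+ (k + 1))^-1 = (v * u ^+ k * (v + u))^-1.
Proof.
move=> u0 v0 w0; elim: k => [|k IH].
  by rewrite big_geq// add0r expr0 mulr1.
(* From k to k + 1 the old terms are divided by v + u and 1 / (u^(k+1) (v + u)^2) is added; then
   1/(v u^k) + 1/u^(k+1) = (v + u) / (v u^(k+1)). *)
rewrite big_nat_recr//=.
have -> : \sum_(1 <= nu < k.+1) (u ^+ nu * (v + u) ^+ (k.+1 + 2 - nu))^-1 =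
    \sum_(1 <= nu < k.+1) (u ^+ nu * (v + u) ^+ (k + 2 - nu))^-1 / (v + u).
  apply: eq_big_nat => nu /andP[_ nuk].
  have -> : (k.+1 + 2 - nu = (k + 2 - nu).+1)%N by lia.
  by rewrite exprSr mulrA invfM.
rewrite -mulr_suml; have -> : (k.+1 + 2 - k.+1 = 2)%N by lia.
rewrite addSn [(v + u) ^+ (k + 1).+1]exprSr (mulrA v)
  [(v * _ * (v + u))^-1]invfM addrAC -mulrDl IH.
rewrite exprS; have : u ^+ k != 0 by rewrite expf_neq0.
by move: (u ^+ k) => w wn0; field; rewrite w0 wn0 u0 v0.
Qed.

Lemma dsum_cvg (R : realType) (D : rel nat) (a : nat -> nat -> R[i]) :
  dsummable D a ->
  (partial_sum (dterm D a) @ totally --> (dsum D a : R[i]^o))%classic.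
Proof. by []. Qed.

Lemma partial_sum_dtermD (R : realType) (D : rel nat) (a b c : nat -> nat -> R[i])
    (A B : R[i]^o) :
  (forall m n, (0 < m)%N -> (0 < n)%N -> c m n = a m n + b m n) ->
  (partial_sum (dterm D a) @ totally --> A)%classic ->
  (partial_sum (dterm D b) @ totally --> B)%classic ->
  (partial_sum (dterm D c) @ totally --> A + B)%classic.
Proof.
move=> cE aA bB.
have -> : partial_sum (dterm D c) =
    partial_sum (dterm D a) \+ partial_sum (dterm D b).
  apply/funext => E; rewrite /partial_sum /= -big_split; apply: eq_bigr => p _.
  rewrite /= /dterm; case: ifP => [/and3P[m0 n0 _]|_]; last by rewrite addr0.
  exact: cE.
exact: (@cvgD _ _ _ _ _ _ _ _ _ aA bB).
Qed.

Lemma partial_sum_dterm_sum (R : realType) (D : rel nat) (k : nat)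
    (a : nat -> nat -> nat -> R[i]) (c : nat -> nat -> R[i]) :
  (forall m n, (0 < m)%N -> (0 < n)%N -> c m n = \sum_(1 <= nu < k) a nu m n) ->
  (forall nu, (1 <= nu < k)%N -> dsummable D (a nu)) ->
  (partial_sum (dterm D c) @ totally -->
    (\sum_(1 <= nu < k) dsum D (a nu) : R[i]^o))%classic.
Proof.
move=> cE aS.
have -> : partial_sum (dterm D c) =
    (fun E => \sum_(1 <= nu < k) partial_sum (dterm D (a nu)) E).
  apply/funext => E; rewrite /partial_sum exchange_big /=.
  apply: eq_bigr => p _; rewrite /dterm.
  case: ifP => [/and3P[m0 n0 _]|_]; last by rewrite big1.
  exact: cE.
rewrite big_nat_cond.
have -> : (fun E => \sum_(1 <= nu < k) partial_sum (dterm D (a nu)) E) =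
    (fun E => \sum_(1 <= nu < k | (1 <= nu < k)%N && true)
      partial_sum (dterm D (a nu)) E).
  by apply/funext => E; rewrite big_nat_cond.
apply: (@cvg_big R[i]^o nat +%R 0) => [z|nu]; first exact: add_continuous.
by rewrite andbT => nuk; exact: dsum_cvg (aS _ nuk).
Qed.

Lemma rows_cvg (R : realType) (D : rel nat) (k n : nat) (x : R[i]) : (0 < k)%N ->
  ((\sum_(0 <= m < M)
    dterm D (fun m n => x ^+ n / (m%:R * n%:R ^+ k * (m + n)%:R)) (m, n))
   @[M --> \oo] -->
  (x ^+ n / n%:R ^+ k *
    (limn (row_psum (D^~ n) n : nat -> R))%:C%C : R[i]^o))%classic.
Proof.
move=> k0.
have E M : \sum_(0 <= m < M)
    dterm D (fun m n => x ^+ n / (m%:R * n%:R ^+ k * (m + n)%:R)) (m, n) =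
    x ^+ n / n%:R ^+ k * (row_psum (D^~ n) n M : R)%:C%C.
  (* The row n = 0 is zero on both sides: [dterm] vanishes there, and the inverse of 0^k is 0 as k >
     0. *)
  have [->|n0] := posnP n.
    rewrite big1 => [|m _]; last by rewrite /dterm /= andbF.
    by rewrite [0%:R ^+ k]expr0n gtn_eqF// invr0 mulr0 mul0r.
  case: M => [|M]; first by rewrite /row_psum !big_geq// mulr0.
  rewrite big_ltn// {1}/dterm /= add0r /row_psum rmorph_sum mulr_sumr.
  rewrite [RHS]big_mkcond; apply: eq_big_nat => m /andP[m0 _].
  rewrite /dterm /= m0 n0 /=; case: ifP => _; last by [].
  rewrite fmorphV rmorphM !rmorph_nat.
  have mR : m%:R != 0 :> R[i] by rewrite pnatr_eq0 -lt0n.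
  have mnR : (m + n)%:R != 0 :> R[i] by rewrite pnatr_eq0 -lt0n addn_gt0 m0.
  rewrite -!mulrA; congr (_ * _); rewrite -!invfM; congr (_^-1); ring.
have [n0|n0] := posnP n.
  have z : x ^+ n / n%:R ^+ k = 0.
    by rewrite n0 [0%:R ^+ k]expr0n gtn_eqF// invr0 mulr0.
  under eq_cvg do rewrite E z mul0r.
  by rewrite z mul0r; exact: cvg_cst.
under eq_cvg do rewrite E.
by apply: cvgMl_tmp; apply: cvg_real_complex; exact: (@row_psum_cvg R _ n n0).
Qed.

Lemma diagonal_sum (R : realType) (D : rel nat) (k l : nat) (x : R[i]) :
  \sum_(0 <= n < l.+1)
    dterm D (fun m n => x ^+ (m + n) / (m%:R * n%:R * (m + n)%:R ^+ k))
      ((l - n)%N, n) =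
  x ^+ l / l%:R ^+ k * (mid_sum (fun n => D (l - n)%N n) l : R)%:C%C.
Proof.
(* The ends n = l and n = 0 of the diagonal have a zero coordinate and drop out, leaving the range
   of [mid_sum]. *)
rewrite big_nat_recr//= {2}/dterm /= subnn /= addr0.
case: l => [|l]; first by rewrite /mid_sum !big_geq// mulr0.
rewrite big_ltn// {1}/dterm /= ?andbF add0r /mid_sum rmorph_sum mulr_sumr.
rewrite [RHS]big_mkcond; apply: eq_big_nat => n /andP[n0 nl].
rewrite /dterm /= n0 subn_gt0 nl subnK 1?ltnW//=; case: ifP => _; last by [].
rewrite fmorphV rmorphM !rmorph_nat.
rewrite -!mulrA; congr (_ * _); rewrite -!invfM; congr (_^-1); ring.
Qed.

(** * Simple series and the polylogarithm *)

Lemma inv_sqr_le_wt (R : realType) (n q : nat) : (0 < n)%N -> (n ^ 2 <= q)%N ->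
  (q%:R)^-1 <= wt n :> R.
Proof.
move=> n0 nq; have nR : 0 < n%:R :> R by rewrite ltr0n.
have n1 : 1 <= n%:R :> R by rewrite ler1n.
have q0 : (0 < q)%N by apply: leq_trans nq; rewrite expn_gt0 n0.
have sn : 0 < Num.sqrt n%:R :> R by rewrite sqrtr_gt0.
rewrite lef_pV2 ?posrE ?mulr_gt0 ?ltr0n//.
apply: (@le_trans _ _ (n%:R ^+ 2)); last by rewrite -natrX ler_nat.
rewrite expr2 ler_pM2l// -(@ler_pXn2r _ 2)// ?nnegrE ?sqrtr_ge0//.
by rewrite sqr_sqrtr// expr2 ler_pMr.
Qed.

Lemma psumsE (R : realType) (P : pred nat) (a : nat -> R[i]) (n : nat) :
  psums P a n =
  \sum_(i <- index_iota 0 n) (if (0 < i)%N && P i then a i else 0).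
Proof.
case: n => [|n]; first by rewrite /psums !big_geq.
rewrite /psums big_ltn// add0r big_mkcond; apply: eq_big_nat => i /andP[-> _].
by [].
Qed.

Lemma csummable_dominated (R : realType) (P : pred nat) (a : nat -> R[i]) :
  (forall n, (0 < n)%N -> `|a n| <= (wt n)%:C%C) -> csummable P a.
Proof.
move=> aw; rewrite /csummable.
pose u i : R[i]^o := if (0 < i)%N && P i then a i else 0.
have /cvg_ex[S uS] : cvg (partial_sum u @ totally)%classic.
  apply: (@cvg_partial_sum_dominated _ _ _ wt _ 3 index_iota_exhausts).
    move=> i; rewrite /u; case: ifP => [/andP[i0 _]|_]; first exact: aw.
    by rewrite normr0 ler0c invr_ge0 mulr_ge0 ?sqrtr_ge0.
  exact: sum_wt_le.
apply/cvg_ex; exists S.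
under eq_cvg do rewrite psumsE.
exact: (partial_sum_exhausts index_iota_exhausts uS).
Qed.

Lemma Li_summable (R : realType) (P : pred nat) (s : nat) (y : R[i]) :
  (2 <= s)%N -> `|y| <= 1 -> csummable P (Li_term s y).
Proof.
move=> s2 y1; apply: csummable_dominated => n n0; rewrite /Li_term -natrX.
rewrite normrM normfV normr_nat normrX.
apply: (@le_trans _ _ ((n ^ s)%:R^-1));
  first by rewrite ler_piMl ?invr_ge0// exprn_ile1.
have -> : (n ^ s)%:R^-1 = ((n ^ s)%:R^-1 : R)%:C%C by rewrite fmorphV rmorph_nat.
by rewrite lecR inv_sqr_le_wt// leq_pexp2l.
Qed.

(** Substituting n = N j matches the partial sum up to N J with the one up to J, and both limits are
    taken along J. *)
Lemma Li_multiples (R : realType) (N s : nat) (x : R[i]) :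
  (0 < N)%N -> (2 <= s)%N -> `|x| <= 1 ->
  csum (fun n => N %| n)%N (Li_term s x) = N%:R ^- s * Li s (x ^+ N).
Proof.
move=> N0 s2 x1.
have xN1 : `|x ^+ N| <= 1 by rewrite normrX exprn_ile1.
have c1 := @Li_summable R (fun n => N %| n)%N _ _ s2 x1.
have c2 := @Li_summable R xpredT _ _ s2 xN1.
have Ny : ((N * J)%N @[J --> \oo] --> \oo)%classic.
  by apply/cvgnyPge => A; exists A => // n /= An; rewrite (leq_trans An)// leq_pmull.
have E J : psums (fun n => N %| n)%N (Li_term s x) (N * J) =
    N%:R ^- s * psums xpredT (Li_term s (x ^+ N)) J.
  (* Index 0 may be added, its term being 0 by the convention on inverses, so that [big_residue]
     applies to the residue 0. *)
  have big0 P M z : psums P (Li_term s z) M =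
      \sum_(0 <= i < M | P i) Li_term s z i.
    rewrite psumsE [RHS]big_mkcond; apply: eq_bigr => -[_|//].
    by rewrite /Li_term [0%:R ^+ s]expr0n (gtn_eqF (ltnW s2)) mulr0n
      invr0 mulr0 !if_same.
  rewrite !big0 [in RHS]big_mkord.
  rewrite (big_residue _ _ N0) mulr_sumr; apply: eq_bigr => j _.
  rewrite add0n /Li_term natrM exprMn invfM exprM; ring.
have l1 := cvg_comp _ _ Ny c1.
have l2 : (psums (fun n => N %| n)%N (Li_term s x) (N * J) @[J --> \oo] -->
   (N%:R ^- s * Li s (x ^+ N) : R[i]^o))%classic.
  under eq_cvg do rewrite E.
  by apply: cvgMl_tmp; exact: c2.
by apply: cvg_unique l1 l2.
Qed.

(** * The identity *)

(** Summing T by rows n = l and H by diagonals m + n = l gives series in l with the same weight x^l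
    / l^k, which combine term by term into [row_total]. *)
Lemma row_series_cvg (R : realType) (D E : rel nat) (N k : nat) (x : R[i])
    (S1 S2 S3 : R[i]^o) :
  odd N -> (0 < k)%N ->
  let T m n : R[i] := x ^+ n / (m%:R * n%:R ^+ k * (m + n)%:R) in
  let H m n : R[i] := x ^+ (m + n) / (m%:R * n%:R * (m + n)%:R ^+ k) in
  (forall n, D^~ n =1 res_eq N n) -> (forall n, E^~ n =1 res_neg N n.*2) ->
  (partial_sum (dterm D T) @ totally --> S1)%classic ->
  (partial_sum (dterm E T) @ totally --> S2)%classic ->
  (partial_sum (dterm E H) @ totally --> S3)%classic ->
  ((\sum_(0 <= l < X) x ^+ l / l%:R ^+ k * (row_total N l : R)%:C%C)
     @[X --> \oo] --> S1 + S2 - S3)%classic.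
Proof.
move=> oN k0 T H DE EE c1 c2 c3.
pose w l := x ^+ l / l%:R ^+ k.
have r1 := partial_sum_rows c1 (fun n => @rows_cvg R D k n x k0).
have r2 := partial_sum_rows c2 (fun n => @rows_cvg R E k n x k0).
have r3 := partial_sum_exhausts diagonals_exhausts c3.
have E3 X : \sum_(p <- diagonals X) dterm E H p =
    \sum_(0 <= l < X) w l * (mid_sum (res_neg N l) l : R)%:C%C.
  rewrite big_diagonals; apply: eq_bigr => l _; rewrite diagonal_sum.
  congr (_ * (_)%:C%C); rewrite /mid_sum big_nat_cond [RHS]big_nat_cond.
  apply: eq_bigl => n; case nl: (1 <= n < l)%N => //=.
  (* On the diagonal m = l - n, so m + 2 n = l + n, and the class of -2 n for m becomes the class of
     -l for n. *)
  rewrite (EE n) /res_neg -addnn addnA subnK 1?addnC//.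
  by move/andP: nl => [_ /ltnW].
have E4 X : \sum_(0 <= l < X) w l * (row_total N l : R)%:C%C =
    \sum_(0 <= l < X) w l * (limn (row_psum (D^~ l) l : nat -> R))%:C%C +
    \sum_(0 <= l < X) w l * (limn (row_psum (E^~ l) l : nat -> R))%:C%C -
    \sum_(p <- diagonals X) dterm E H p.
  rewrite E3 -big_split -sumrB /=; apply: eq_bigr => l _.
  have -> : D^~ l = res_eq N l by apply/funext => m; exact: DE.
  have -> : E^~ l = res_neg N l.*2 by apply/funext => m; exact: EE.
  by rewrite /row_total rmorphB rmorphD mulrBr mulrDr.
under eq_cvg do rewrite E4.
exact: (@cvgB _ _ _ _ _ _ _ _ _ (@cvgD _ _ _ _ _ _ _ _ _ r1 r2) r3).
Qed.

Lemma row_series_split (R : realType) (N k X : nat) (x : R[i]) :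
  odd N -> (0 < k)%N ->
  let e m := x ^+ m / ((sin (2 * m%:R * pi / N%:R))%:C%C * m%:R ^+ (k + 1)) in
  \sum_(0 <= l < X) x ^+ l / l%:R ^+ k * (row_total N l : R)%:C%C =
  2 * psums (fun m => N %| m)%N (Li_term (k + 2) x) X +
  (pi / N%:R)%:C%C * psums (fun m => ~~ (N %| m)%N) e X.
Proof.
move=> oN k0 e; rewrite !psumsE !mulr_sumr -big_split /=.
apply: eq_bigr => -[|l] _.
  (* At l = 0 the left side is 0 because 0^k has inverse 0, and both series on the right start at
     1. *)
  by rewrite [0%:R ^+ k]expr0n gtn_eqF//= invr0 mulr0 mul0r !mulr0 addr0.
rewrite row_total_eq//= /Li_term /e !exprD expr1.
case: (N %| l.+1)%N => /=; rewrite !mulr0 ?addr0 ?add0r.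
  by rewrite fmorph_div rmorphXn !rmorph_nat [(_ ^+ k * _)^-1]invfM; ring.
move: (sin _) (pi / N%:R) => t p.
have -> : (p / (t * l.+1%:R))%:C%C = p%:C%C / (t%:C%C * l.+1%:R) :> R[i].
  by rewrite [LHS]fmorph_div [in LHS]rmorphM /= rmorph_nat.
by rewrite mulrACA -invfM mulrA (mulrC p%:C%C) -!mulrA; congr (_ * (_ * _^-1)); ring.
Qed.

Theorem theorem1p6 (R : realType) (N k : nat) (x : R[i]) :
  odd N -> (0 < k)%N -> `|x| <= 1 ->
  let same (m n : nat) := (m == n %[mod N])%N in
  let opp2 (m n : nat) := (m%:Z == (- 2%:Z) * n%:Z %[mod N%:Z])%Z in
  let a (nu m n : nat) : R[i] :=
    x ^+ n / (n%:R ^+ nu * (m + n)%:R ^+ (k + 2 - nu)) in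
  let b (m n : nat) : R[i] := x ^+ n / (m%:R * (m + n)%:R ^+ (k + 1)) in
  let c (m n : nat) : R[i] := x ^+ (m + n) / (m%:R * (m + n)%:R ^+ (k + 1)) in
  let d (m n : nat) : R[i] := x ^+ (m + n) / (n%:R * (m + n)%:R ^+ (k + 1)) in
  let ndvd (m : nat) := ~~ (N %| m)%N in
  let e (m : nat) : R[i] :=
    x ^+ m / ((sin (2 * m%:R * pi / N%:R))%:C%C * m%:R ^+ (k + 1)) in
  [/\ forall nu : nat, (1 <= nu <= k)%N ->
        dsummable same (a nu) /\ dsummable opp2 (a nu),
      dsummable same b,
      [/\ dsummable opp2 b, dsummable opp2 c & dsummable opp2 d],
      csummable xpredT (Li_term (k + 2) (x ^+ N)) /\ csummable ndvd e &
      \sum_(1 <= nu < k.+1) dsum same (a nu) + dsum same b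
      + \sum_(1 <= nu < k.+1) dsum opp2 (a nu) + dsum opp2 b
      - dsum opp2 c - dsum opp2 d
      = 2 / N%:R ^+ (k + 2) * Li (k + 2) (x ^+ N)
        + (pi / N%:R)%:C%C * csum ndvd e].
Proof.
move=> oN k0 x1 same opp2 a b c d ndvd e.
have N0 : (0 < N)%N by case: (N) oN.
have nat0 m : (0 < m)%N -> m%:R != 0 :> R[i] by rewrite pnatr_eq0 -lt0n.
have aS nu D : (1 <= nu <= k)%N -> dsummable D (a nu).
  move=> /andP[nu1 nuk]; apply: dsummable_dominated => m n m0 n0.
  rewrite /a -!natrX -natrM; apply: norm_term_le => //.
  apply: leq_mul.
    by apply: leq_trans (geq_minr _ _) _; rewrite -{1}(expn1 n) leq_pexp2l.
  by rewrite leq_pexp2l ?addn_gt0 ?m0//; lia.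
have k1 m : (m ^ 2 <= m ^ (k + 1))%N.
  by case: m => [|m]; [rewrite addn1 | rewrite leq_pexp2l// addn1].
have bS D : dsummable D b.
  apply: dsummable_dominated => m n m0 n0.
  rewrite /b -!natrX -natrM; apply: norm_term_le => //.
  by apply: leq_mul => //; exact: geq_minl.
have cS D : dsummable D c.
  apply: dsummable_dominated => m n m0 n0.
  rewrite /c -!natrX -natrM; apply: norm_term_le => //.
  by apply: leq_mul => //; exact: geq_minl.
have dS D : dsummable D d.
  apply: dsummable_dominated => m n m0 n0.
  rewrite /d -!natrX -natrM; apply: norm_term_le => //.
  by apply: leq_mul => //; exact: geq_minr.
(* T is the closed form of all terms a and b by partial fractions; H is that of c + d, since 1/m +
   1/n = (m + n)/(m n). *)
pose T m n : R[i] := x ^+ n / (m%:R * n%:R ^+ k * (m + n)%:R).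
pose H m n : R[i] := x ^+ (m + n) / (m%:R * n%:R * (m + n)%:R ^+ k).
have TS D : (partial_sum (dterm D T) @ totally -->
    (\sum_(1 <= nu < k.+1) dsum D (a nu) + dsum D b : R[i]^o))%classic.
  apply: (@partial_sum_dtermD _ _ (fun m n => \sum_(1 <= nu < k.+1) a nu m n) b).
  - move=> m n m0 n0; rewrite /T /a /b -mulr_sumr -mulrDr natrD.
    by rewrite partial_fractions ?nat0// -natrD nat0// addn_gt0 m0.
  - by apply: partial_sum_dterm_sum => // nu nuk; exact: aS.
  - exact: dsum_cvg (bS D).
have HS D : (partial_sum (dterm D H) @ totally -->
    (dsum D c + dsum D d : R[i]^o))%classic.
  apply: (@partial_sum_dtermD _ _ c d).
  - move=> m n m0 n0; rewrite /H /c /d -mulrDr; congr (_ * _).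
    have mn0 : (m + n)%:R != 0 :> R[i] by rewrite nat0// addn_gt0 m0.
    have mn1 : (m + n)%:R ^+ k != 0 :> R[i] by rewrite expf_neq0.
    rewrite exprD expr1; move: mn1; move: (_ ^+ k) => w w0.
    by rewrite natrD in mn0 *; field; rewrite !nat0 ?mn0 ?w0.
  - exact: dsum_cvg (cS D).
  - exact: dsum_cvg (dS D).
have opp2E n : opp2^~ n =1 res_neg N n.*2.
  move=> m; rewrite /opp2 /res_neg eqz_mod_dvd mulNr opprK -PoszM -PoszD.
  by rewrite dvdzE /= mul2n.
have lim1 := @row_series_cvg _ same opp2 _ _ _ _ _ _ oN k0 (fun n m => erefl) opp2E
  (TS same) (TS opp2) (HS opp2).
have k2 : (2 <= k + 2)%N by rewrite leq_addl.
have cM := @Li_summable R (fun m => N %| m)%N _ _ k2 x1.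
have Np : (pi / N%:R)%:C%C != 0 :> R[i].
  by rewrite fmorph_eq0 mulf_neq0 ?invr_eq0 ?pnatr_eq0 -?lt0n// gt_eqF// pi_gt0.
set p : R[i] := (pi / N%:R)%:C%C in Np *.
set S : R[i]^o := (X in (_ --> X)%classic) in lim1.
(* The sine series is obtained by solving the split identity for it: it converges as a combination
   of two convergent series, and its sum comes out at the same time. *)
have eE X : psums ndvd e X = p^-1 * (\sum_(0 <= l < X)
    x ^+ l / l%:R ^+ k * (row_total N l : R)%:C%C -
    2 * psums (fun m => N %| m)%N (Li_term (k + 2) x) X).
  by rewrite row_series_split// addrC addKr mulKf.
have eL : (psums ndvd e X @[X --> \oo] -->
    (p^-1 * (S - 2 * csum (fun m => N %| m)%N (Li_term (k + 2) x)) :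
      R[i]^o))%classic.
  under eq_cvg do rewrite eE.
  apply: (@cvgMl_tmp R[i]).
  apply: (@cvgB _ _ _ _ _ _ _ _ _ lim1).
  exact: (@cvgMl_tmp R[i] _ _ _ _ _ _ cM).
have eS : csummable ndvd e by apply/cvg_ex; eexists; exact: eL.
split.
- by move=> nu nuk; split; exact: aS.
- exact: bS.
- by split; [exact: bS | exact: cS | exact: dS].
- split; last exact: eS.
  by apply: Li_summable; [exact: k2 | rewrite normrX exprn_ile1].
have -> : csum ndvd e =
    p^-1 * (S - 2 * csum (fun m => N %| m)%N (Li_term (k + 2) x)).
  exact: norm_cvg_lim eL.
rewrite mulVKf// Li_multiples// -/p.
rewrite -mulrA [RHS]addrC subrK /S opprD !addrA.
reflexivity.
Qed.
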